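(* Let $\mathbb{K}\in\{\mathbb{R},\mathbb{C},\mathbb{H},\mathbb{O}\}$ and $\mathbb{K}'\in\{\mathbb{R}',\mathbb{C}',\mathbb{H}',\mathbb{O}'\}$. The subalgebra of $\mathrm{End}(\mathcal{K}^{4\times4})$ (with composition as product) generated by $\mathbf{V}_4=\Gamma_L(\mathbf{V}_2)$ is a Clifford algebra, namely the Clifford algebra $\mathrm{C}\ell(\mathbf{V}_4)=\mathrm{C}\ell(\kappa+\kappa'_+,\kappa'_-)$ of the quadratic space $\mathbf{V}_4$.
   Context: Algebras: $\mathbb{K}$ is one of the normed division algebras $\mathbb{R},\mathbb{C},\mathbb{H},\mathbb{O}$, with conjugation $a\mapsto\bar a$ and positive definite norm $|a|^2=a\bar a$. $\mathbb{K}'$ is one of the split composition algebras $\mathbb{R}'=\mathbb{R}$, $\mathbb{C}'$ (split complex numbers), $\mathbb{H}'$ (split quaternions), $\mathbb{O}'$ (split octonions), with conjugation $A\mapsto A^*$ and norm $|A|^2=AA^*$ of split signature. $\mathcal{K}=\mathbb{K}'\otimes_{\mathbb{R}}\mathbb{K}$ has product $(A\otimes a)(B\otimes b)=AB\otimes ab$; $\mathbb{K}$ and $\mathbb{K}'$ are regarded as commuting subalgebras of $\mathcal{K}$. Set $\kappa=\dim\mathbb{K}\in\{1,2,4,8\}$, and let $\kappa'_+\in\{1,1,2,4\}$ and $\kappa'_-\in\{0,1,2,4\}$ be the numbers of positive and negative directions of the norm on $\mathbb{K}'=\mathbb{R}',\mathbb{C}',\mathbb{H}',\mathbb{O}'$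 respectively. Matrices: $\mathbf{V}_2$ is the real vector space of $2\times2$ matrices over $\mathcal{K}$ of the form $\mathbf{X}=\begin{pmatrix}A&\bar a\\ a&-A^*\end{pmatrix}$ with $a\in\mathbb{K}$, $A\in\mathbb{K}'$, so that $-\det\mathbf{X}=|A|^2+|a|^2$. Put $\widetilde{\mathbf{X}}=\mathbf{X}-\mathrm{tr}(\mathbf{X})\,\mathbf{I}$ and let $\Gamma(\mathbf{X})=\begin{pmatrix}0&\mathbf{X}\\ \widetilde{\mathbf{X}}&0\end{pmatrix}$, a $4\times4$ matrix over $\mathcal{K}$. $\mathcal{K}^{4\times4}$ is the real vector space of $4\times4$ matrices over $\mathcal{K}$, and $\mathrm{End}(\mathcal{K}^{4\times4})$ is the associative algebra of its real-linear endomorphisms under composition. For a $4\times4$ matrix $\mathbf{P}$, $\mathbf{P}_L\in\mathrm{End}(\mathcal{K}^{4\times4})$ is $\mathbf{P}_L(\mathbf{Q})=\mathbf{P}\mathbf{Q}$ (matrix product), and $\Gamma_L(\mathbf{X})=\Gamma(\mathbf{X})_L$. The space $\mathbf{V}_4=\Gamma_L(\mathbf{V}_2)$ carries the quadratic form $\Gamma_L(\mathbf{X})\mapsto-\det\mathbf{X}$, of signature $(\kappa+\kappa'_+,\kappa'_-)$ (numbers of plus and minus signs). Convention: the Clifford algebra $\mathrm{C}\ell(V)$ of a real quadratic space satisfies $v\cdot v=+|v|^2\,1$ where $|v|^2$ is the value of the quadratic form on $v\in V$; $\mathrm{C}\ell(m,n)$ is the Clifford algebra of the form with $m$ plus signs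 and $n$ minus signs. *)

(* Defs.v *)
From HB Require Import structures.
From mathcomp Require Import all_boot all_order all_algebra all_field.

Set Implicit Arguments.
Unset Strict Implicit.
Unset Printing Implicit Defensive.

Import GRing.Theory.
Local Open Scope ring_scope.

(* Not necessarily associative unital algebras with a linear conjugation,
   given in coordinates. *)
Record star_algebra (R : fieldType) := StarAlgebra {
  sdim : nat;
  smul : 'rV[R]_sdim -> 'rV[R]_sdim -> 'rV[R]_sdim;
  sone : 'rV[R]_sdim;
  sconj : 'rV[R]_sdim -> 'rV[R]_sdim;
  smul_linear_l : forall y, linear (smul^~ y);
  smul_linear_r : forall x, linear (smul x);
  sconj_linear : linear sconj;
  sone_neq0 : sone != 0;
  smul1l : left_id sone smul;
  smul1r : right_id sone smul;
  sconj1 : sconj sone = sone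
}.

Section CayleyDickson.
Variable R : fieldType.

Definition real_alg : star_algebra R.
Proof.
refine (@StarAlgebra R 1 (fun x y => \row_i (x 0 i * y 0 i)) (const_mx 1) id
          _ _ _ _ _ _ _).
- by move=> y c u v; apply/rowP=> i; rewrite !mxE mulrDl mulrA.
- by move=> x c u v; apply/rowP=> i; rewrite !mxE mulrDr mulrCA.
- by [].
- by apply/eqP=> /rowP/(_ 0)/eqP; rewrite !mxE oner_eq0.
- by move=> x; apply/rowP=> i; rewrite !mxE mul1r.
- by move=> x; apply/rowP=> i; rewrite !mxE mulr1.
- by [].
Defined.

Section Double.
Variables (g : R) (A : star_algebra R).
Local Notation n := (sdim A).

(* (a, b)(c, d) = (ac + g d^* b, da + b c^* ), so that the norm of (a, b) is
   |a|^2 - g |b|^2. *)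
Definition cd_mul (x y : 'rV[R]_(n + n)) : 'rV[R]_(n + n) :=
  let a := lsubmx x in let b := rsubmx x in
  let c := lsubmx y in let d := rsubmx y in
  row_mx (smul a c + g *: smul (sconj d) b) (smul d a + smul b (sconj c)).

Definition cd_one : 'rV[R]_(n + n) := row_mx (sone A) 0.

Definition cd_conj (x : 'rV[R]_(n + n)) : 'rV[R]_(n + n) :=
  row_mx (sconj (lsubmx x)) (- rsubmx x).

Lemma cd_mul_linear_l y : linear (cd_mul^~ y).
Proof.
move=> c u v; rewrite /cd_mul !linearP /= !smul_linear_l !smul_linear_r.
rewrite scale_row_mx add_row_mx !scalerDr !scalerA (mulrC g c).
by congr row_mx; rewrite addrACA.
Qed.

Lemma cd_mul_linear_r x : linear (cd_mul x).
Proof.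
move=> c u v; rewrite /cd_mul !linearP /= !sconj_linear.
rewrite !smul_linear_l !smul_linear_r.
rewrite scale_row_mx add_row_mx !scalerDr !scalerA (mulrC g c).
by congr row_mx; rewrite addrACA.
Qed.

Lemma cd_conj_linear : linear cd_conj.
Proof.
move=> c u v; rewrite /cd_conj !linearP /= sconj_linear.
by rewrite scale_row_mx add_row_mx.
Qed.

Let lin0 (f : 'rV[R]_n -> 'rV[R]_n) : linear f -> f 0 = 0.
Proof.
move=> /(_ 1 0 0)/eqP.
by rewrite !scale1r addr0 -subr_eq subrr eq_sym => /eqP.
Qed.

Let smul0r (x : 'rV[R]_n) : smul x 0 = 0.
Proof. exact: lin0 (smul_linear_r x). Qed.

Let smul0l (x : 'rV[R]_n) : smul 0 x = 0.
Proof. exact: lin0 (smul_linear_l x). Qed.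

Let sconj0 : sconj (0 : 'rV[R]_n) = 0.
Proof. exact: lin0 (@sconj_linear _ A). Qed.

Lemma cd_one_neq0 : cd_one != 0.
Proof.
apply: contraNneq (sone_neq0 A) => /(congr1 lsubmx).
by rewrite row_mxKl linear0 => ->.
Qed.

Lemma cd_mul1l : left_id cd_one cd_mul.
Proof.
move=> x; rewrite /cd_mul /cd_one row_mxKl row_mxKr smul1l smul1r smul0r smul0l.
by rewrite scaler0 !addr0 hsubmxK.
Qed.

Lemma cd_mul1r : right_id cd_one cd_mul.
Proof.
move=> x; rewrite /cd_mul /cd_one row_mxKl row_mxKr sconj1 sconj0 !smul1r.
by rewrite !smul0l scaler0 addr0 add0r hsubmxK.
Qed.

Lemma cd_conj1 : cd_conj cd_one = cd_one.
Proof. by rewrite /cd_conj /cd_one row_mxKl row_mxKr sconj1 oppr0. Qed.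

Definition cayley_dickson : star_algebra R :=
  @StarAlgebra R (n + n) cd_mul cd_one cd_conj
    cd_mul_linear_l cd_mul_linear_r cd_conj_linear
    cd_one_neq0 cd_mul1l cd_mul1r cd_conj1.

End Double.

End CayleyDickson.

Variant division_alg := DivR | DivC | DivH | DivO.
Variant split_alg := SplitR | SplitC | SplitH | SplitO.

Section Algebras.
Variable R : fieldType.

Definition div_star (K : division_alg) : star_algebra R :=
  let r := real_alg R in
  let c := cayley_dickson (-1) r in
  let h := cayley_dickson (-1) c in
  match K with
  | DivR => r
  | DivC => c
  | DivH => h
  | DivO => cayley_dickson (-1) h
  end.

(* Only the last doubling has its sign changed. *)
Definition split_star (K' : split_alg) : star_algebra R :=
  match K' with
  | SplitR => real_alg R
  | SplitC => cayley_dickson 1 (div_star DivR)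
  | SplitH => cayley_dickson 1 (div_star DivC)
  | SplitO => cayley_dickson 1 (div_star DivH)
  end.

End Algebras.

Definition kappa (K : division_alg) : nat :=
  match K with DivR => 1 | DivC => 2 | DivH => 4 | DivO => 8 end.

Definition kappa'_pos (K' : split_alg) : nat :=
  match K' with SplitR => 1 | SplitC => 1 | SplitH => 2 | SplitO => 4 end.

Definition kappa'_neg (K' : split_alg) : nat :=
  match K' with SplitR => 0 | SplitC => 1 | SplitH => 2 | SplitO => 4 end.

Section Tensor.
Variables (R : fieldType) (A' A : star_algebra R).

(* The matrix M stands for \sum_(i, j) M i j *: e_i (x) e_j. *)
Definition tensor := 'M[R]_(sdim A', sdim A).

Definition tens (a' : 'rV[R]_(sdim A')) (a : 'rV[R]_(sdim A)) : tensor :=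
  a'^T *m a.

Definition tone : tensor := tens (sone A') (sone A).

Definition tmul (M N : tensor) : tensor :=
  \sum_i \sum_j \sum_k \sum_l (M i k * N j l) *:
    tens (smul (delta_mx 0 i) (delta_mx 0 j))
         (smul (delta_mx 0 k) (delta_mx 0 l)).

Lemma tmul_linear_l N : linear (tmul^~ N).
Proof.
move=> c M M'; rewrite /tmul scaler_sumr -big_split /=; apply: eq_bigr => i _.
rewrite scaler_sumr -big_split /=; apply: eq_bigr => j _.
rewrite scaler_sumr -big_split /=; apply: eq_bigr => k _.
rewrite scaler_sumr -big_split /=; apply: eq_bigr => l _.
by rewrite !mxE scalerA -scalerDl mulrDl mulrA.
Qed.

Lemma tmul_linear_r M : linear (tmul M).
Proof.
move=> c N N'; rewrite /tmul scaler_sumr -big_split /=; apply: eq_bigr => i _.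
rewrite scaler_sumr -big_split /=; apply: eq_bigr => j _.
rewrite scaler_sumr -big_split /=; apply: eq_bigr => k _.
rewrite scaler_sumr -big_split /=; apply: eq_bigr => l _.
by rewrite !mxE scalerA -scalerDl mulrDr mulrCA.
Qed.

Lemma tmul1r M : tmul M tone = M.
Proof.
have sum1 (B : star_algebra R) (b : 'rV[R]_(sdim B)) :
    \sum_i sone B 0 i *: smul b (delta_mx 0 i) = b.
  pose F : {linear 'rV[R]_(sdim B) -> 'rV[R]_(sdim B)} :=
    HB.pack (smul b) (GRing.isLinear.Build _ _ _ _ (smul b) (@smul_linear_r R B b)).
  rewrite -[RHS]smul1r [in RHS](row_sum_delta (sone B)).
  rewrite -[smul b _]/(F _) linear_sum.
  by apply: eq_bigr => i _; rewrite linearZ.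
have tensD1 (c : 'rV[R]_(sdim A')) (d : 'rV[R]_(sdim A)) i j :
    tens c d i j = c 0 i * d 0 j by rewrite /tens !mxE big_ord1 !mxE.
rewrite {2}[M]matrix_sum_delta; apply: eq_bigr => i _.
rewrite exchange_big /=; apply: eq_bigr => k _.
transitivity (M i k *: tens (\sum_j sone A' 0 j *: smul (delta_mx 0 i) (delta_mx 0 j))
   (\sum_l sone A 0 l *: smul (delta_mx 0 k) (delta_mx 0 l))).
  rewrite /tens [(\sum_j _)^T]linear_sum mulmx_suml scaler_sumr.
  apply: eq_bigr => j _ /=; rewrite mulmx_sumr scaler_sumr; apply: eq_bigr => l _.
  rewrite [(_ *: _)^T]linearZ -scalemxAr -scalemxAl !scalerA tensD1.
  by rewrite (mulrC (sone A 0 l)).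
by rewrite !sum1 /tens trmx_delta mul_delta_mx.
Qed.

Lemma smul_coord (B : star_algebra R) (a b : 'rV[R]_(sdim B)) :
  smul a b =
  \sum_i \sum_j (a 0 i * b 0 j) *: smul (delta_mx 0 i) (delta_mx 0 j).
Proof.
have sumL (f : 'rV[R]_(sdim B) -> 'rV[R]_(sdim B)) (c : 'rV[R]_(sdim B)) :
    linear f -> f c = \sum_i c 0 i *: f (delta_mx 0 i).
  move=> lf; pose F : {linear _ -> _} := HB.pack f (GRing.isLinear.Build _ _ _ _ f lf).
  rewrite {1}[c]row_sum_delta -[f]/(F : _ -> _) linear_sum.
  by apply: eq_bigr => i _; rewrite linearZ.
rewrite (sumL (fun x => smul x b) a (@smul_linear_l R B b)); apply: eq_bigr => i _.
rewrite (sumL (smul (delta_mx 0 i)) b (@smul_linear_r R B _)) scaler_sumr.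
by apply: eq_bigr => j _; rewrite scalerA.
Qed.

Lemma tmul_tens (a' b' : 'rV[R]_(sdim A')) (a b : 'rV[R]_(sdim A)) :
  tmul (tens a' a) (tens b' b) = tens (smul a' b') (smul a b).
Proof.
rewrite [in RHS](smul_coord a' b') [in RHS](smul_coord a b) /tmul /tens.
rewrite [(\sum_i _)^T]linear_sum mulmx_suml; apply: eq_bigr => i _ /=.
rewrite [(\sum_j _)^T]linear_sum mulmx_suml; apply: eq_bigr => j _ /=.
rewrite mulmx_sumr; apply: eq_bigr => k _.
rewrite mulmx_sumr; apply: eq_bigr => l _.
rewrite [(_ *: _)^T]linearZ -scalemxAr -scalemxAl scalerA /tens !mxE !big_ord1 !mxE.
by congr (_ *: _); rewrite mulrACA mulrC.
Qed.

End Tensor.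

(* n x n matrices over the tensor product, an alias of the library's matrices
   carrying their structure of real vector space. *)
Definition kmx (R : fieldType) (A' A : star_algebra R) (n : nat) :=
  'M[tensor A' A]_n.

Section MatrixSpace.
Variables (R : fieldType) (A' A : star_algebra R) (n : nat).
Local Notation T := (tensor A' A).
Local Notation M := (kmx A' A n).

HB.instance Definition _ := GRing.Zmodule.copy M 'M[T]_n.

Definition kscale (c : R) (P : M) : M := \matrix_(i, j) (c *: P i j).

Fact kscaleA a b P : kscale a (kscale b P) = kscale (a * b) P.
Proof. by apply/matrixP=> i j; rewrite !mxE scalerA. Qed.
Fact kscale1 : left_id 1 kscale.
Proof. by move=> P; apply/matrixP=> i j; rewrite !mxE scale1r. Qed.
Fact kscaleDr : right_distributive kscale +%R.
Proof. by move=> c P Q; apply/matrixP=> i j; rewrite !mxE scalerDr. Qed.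
Fact kscaleDl P : {morph kscale^~ P : a b / a + b}.
Proof. by move=> a b; apply/matrixP=> i j; rewrite !mxE scalerDl. Qed.

HB.instance Definition _ :=
  GRing.Zmodule_isLmodule.Build R M kscaleA kscale1 kscaleDr kscaleDl.

Fact kmx_vect_iso :
  Vector.axiom (#|{: 'I_n * 'I_n}| * (sdim A' * sdim A)) M.
Proof.
pose f (P : M) := mxvec (\matrix_(k < #|{: 'I_n * 'I_n}|)
  mxvec (P (enum_val k).1 (enum_val k).2)).
pose h r : M :=
  \matrix_(i, j) vec_mx (row (enum_rank (i, j)) (vec_mx r)).
exists f.
  move=> c P Q; rewrite /f -[RHS]linearP; congr mxvec; apply/row_matrixP => k.
  by rewrite linearP /= !rowK !mxE linearP.
exists h => [P|r].
  by apply/matrixP=> i j; rewrite mxE mxvecK rowK enum_rankK mxvecK.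
apply: (canLR vec_mxK); apply/row_matrixP => k.
by rewrite rowK mxE -surjective_pairing enum_valK vec_mxK.
Qed.

HB.instance Definition _ := Lmodule_hasFinDim.Build R M kmx_vect_iso.

Definition kmulmx (P Q : M) : M := \matrix_(i, j) \sum_k tmul (P i k) (Q k j).

Lemma kmulmx_linear_l Q : linear (kmulmx^~ Q).
Proof.
move=> c P P'; apply/matrixP=> i j; rewrite !mxE scaler_sumr -big_split /=.
by apply: eq_bigr => k _; rewrite !mxE tmul_linear_l.
Qed.

Lemma kmulmx_linear_r P : linear (kmulmx P).
Proof.
move=> c Q Q'; apply/matrixP=> i j; rewrite !mxE scaler_sumr -big_split /=.
by apply: eq_bigr => k _; rewrite !mxE tmul_linear_r.
Qed.

HB.instance Definition _ P :=
  GRing.isLinear.Build R M M _ (kmulmx P) (kmulmx_linear_r P).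

End MatrixSpace.

(* Real-linear endomorphisms of the 4 x 4 matrices, with product f \o g (the
   library's own ring structure on endomorphisms uses the opposite product). *)
Definition kend (R : fieldType) (A' A : star_algebra R) := 'End(kmx A' A 4).

Section Endomorphisms.
Variables (R : fieldType) (A' A : star_algebra R).
Local Notation E := (kend A' A).

HB.instance Definition _ := Vector.copy E 'End(kmx A' A 4).

Fact kend_proper : (0 < dim (kmx A' A 4))%N.
Proof.
have gt0 (B : star_algebra R) : (0 < sdim B)%N.
  rewrite lt0n; apply: contraNneq (sone_neq0 B) => B0; apply/eqP/rowP=> i.
  by have := ltn_ord i; rewrite {2}B0.
have gt0x : (0 < sdim A' * sdim A)%N by rewrite muln_gt0 !gt0.
by rewrite [dim _]/(_ * _)%N muln_gt0 card_prod card_ord gt0x.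
Qed.

HB.instance Definition _ := GRing.Zmodule_isNzRing.Build E
  (@comp_lfunA _ _ _ _ _) (@comp_lfun1l _ _ _) (@comp_lfun1r _ _ _)
  (@comp_lfunDl _ _ _ _) (@comp_lfunDr _ _ _ _) (lfun1_neq0 kend_proper).

HB.instance Definition _ := GRing.Lmodule_isLalgebra.Build R E
  (fun c (f g : E) => comp_lfunZl c f g).

HB.instance Definition _ := GRing.Lalgebra_isAlgebra.Build R E
  (fun c (f g : E) => comp_lfunZr c f g).

HB.instance Definition _ := Algebra_isFalgebra.Build R E.

Lemma kend_mulE (f g : E) Q : (f * g) Q = f (g Q).
Proof. exact: comp_lfunE. Qed.

Definition left_mul (P : kmx A' A 4) : E := linfun (kmulmx P).

Lemma left_mulE P Q : left_mul P Q = kmulmx P Q.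
Proof. exact: lfunE. Qed.

End Endomorphisms.

Section Gamma.
Variables (R : fieldType) (A' A : star_algebra R).

Definition tilde (X : kmx A' A 2) : kmx A' A 2 := X - (\tr X)%:M.

Definition Gamma (X : kmx A' A 2) : kmx A' A 4 :=
  block_mx (0 : 'M_2) X (tilde X) (0 : 'M_2).

Definition Gamma_L (X : kmx A' A 2) : kend A' A := left_mul (Gamma X).

Lemma Gamma_L_linear : linear Gamma_L.
Proof.
have trL c (X Y : kmx A' A 2) : \tr (c *: X + Y) = c *: \tr X + \tr Y.
  by rewrite mxtraceD; congr (_ + _); rewrite scaler_sumr; apply: eq_bigr => i _;
    rewrite mxE.
have tL : linear tilde.
  move=> c X Y; apply/matrixP=> i j; rewrite /tilde trL !mxE.
  by case: eqP => _; rewrite ?mulr1n ?mulr0n ?subr0 // scalerBr opprD addrACA.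
have GL : linear Gamma.
  move=> c X Y; rewrite /Gamma tL; apply/matrixP=> i j.
  rewrite !mxE; case: splitP => i' _; rewrite !mxE; case: splitP => j' _;
    by rewrite !mxE ?scaler0 ?addr0.
move=> c X Y; apply/lfunP=> Q; rewrite /Gamma_L add_lfunE scale_lfunE.
by rewrite !left_mulE GL kmulmx_linear_l.
Qed.

HB.instance Definition _ :=
  GRing.isLinear.Build R (kmx A' A 2) (kend A' A) _ Gamma_L Gamma_L_linear.

Lemma Gamma_L_inj : injective Gamma_L.
Proof.
move=> X Y XY.
have kmulm1 (P : kmx A' A 4) : kmulmx P (tone A' A)%:M = P.
  apply/matrixP=> i j; rewrite mxE (bigD1 j) //= big1 => [|k /negPf kj].
    by rewrite mxE eqxx mulr1n tmul1r addr0.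
  rewrite mxE kj mulr0n; have := tmul_linear_r (P i k) 1 0 0.
  by move/eqP; rewrite !scale1r addr0 -subr_eq subrr eq_sym => /eqP.
have : Gamma X = Gamma Y.
  by rewrite -[Gamma X]kmulm1 -[Gamma Y]kmulm1 -!left_mulE -/(Gamma_L _) XY.
by move=> GXY; case: (@eq_block_mx _ 2 2 2 2 _ _ _ _ _ _ _ _ GXY).
Qed.

Definition mx22 (T : Type) (a b c d : T) : 'M[T]_2 :=
  \matrix_(i, j) if i == 0 then (if j == 0 then a else b)
                 else (if j == 0 then c else d).

Definition V2_mx (p : 'rV[R]_(sdim A') * 'rV[R]_(sdim A)) : kmx A' A 2 :=
  mx22 (tens p.1 (sone A)) (tens (sone A') (sconj p.2))
       (tens (sone A') p.2) (- tens (sconj p.1) (sone A)).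

Lemma V2_mx_linear : linear V2_mx.
Proof.
have tL (B' B : star_algebra R) (b : 'rV[R]_(sdim B)) :
    linear (fun a : 'rV[R]_(sdim B') => tens a b).
  by move=> c u v; rewrite /tens linearP /= mulmxDl -scalemxAl.
have tR (B' B : star_algebra R) (b : 'rV[R]_(sdim B')) :
    linear (fun a : 'rV[R]_(sdim B) => tens b a).
  by move=> c u v; rewrite /tens mulmxDr -scalemxAr.
move=> c p q; apply/matrixP=> i j; rewrite !mxE /= !sconj_linear tL !tR tL.
by do 2!case: ifP => _ //; rewrite scalerN opprD.
Qed.

HB.instance Definition _ := GRing.isLinear.Build R _ _ _ V2_mx V2_mx_linear.

Definition V2 : {vspace kmx A' A 2} := limg (linfun V2_mx).

Definition V4 : {vspace kend A' A} := (linfun Gamma_L @: V2)%VS.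

Definition kdet2 (X : kmx A' A 2) : tensor A' A :=
  tmul (X 0 0) (X 1 1) - tmul (X 0 1) (X 1 0).

(* The real number c such that t = c *: tone A' A, when there is one. *)
Definition scalar_of (t : tensor A' A) : R :=
  coord [tuple tone A' A] 0 t.

Definition V2_form (X : kmx A' A 2) : R := scalar_of (- kdet2 X).

Definition V4_form (v : subvs_of V4) : R :=
  V2_form ((linfun Gamma_L)^-1%VF (vsval v)).

Lemma V4_formE X (V4X : Gamma_L X \in V4) :
  V4_form (Subvs V4X) = V2_form X.
Proof.
rewrite /V4_form /= -[Gamma_L X]lfunE lker0_lfunK //.
by apply/lker0P=> Y Z; rewrite !lfunE => /Gamma_L_inj.
Qed.

(* <<V4>>%AS is the unital subalgebra of kend generated by V4. *)
Definition V4_incl (v : subvs_of V4) : subvs_of <<V4>>%AS :=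
  Subvs (subvP (sub_agenv V4) _ (subvsP v)).

Lemma V4_incl_linear : linear V4_incl.
Proof. by move=> c u v; apply: val_inj. Qed.

HB.instance Definition _ := GRing.isLinear.Build R _ _ _ V4_incl V4_incl_linear.

End Gamma.

(* The universal property of the Clifford algebra of (V, q), with the sign
   convention v * v = + q v. *)
Definition is_clifford (R : fieldType) (V : lmodType R) (q : V -> R)
    (C : algType R) (j : {linear V -> C}) : Prop :=
  (forall v, j v * j v = (q v)%:A) /\
  forall (B : algType R) (f : {linear V -> B}),
    (forall v, f v * f v = (q v)%:A) ->
    exists phi : {lrmorphism C -> B},
      (forall v, phi (j v) = f v) /\
      forall psi : {lrmorphism C -> B},
        (forall v, psi (j v) = f v) -> psi =1 phi.

(* The diagonal form with p plus signs followed by m minus signs. *)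
Definition std_form (R : fieldType) (p m : nat) (x : 'rV[R]_(p + m)) : R :=
  \sum_i lsubmx x 0 i ^+ 2 - \sum_i rsubmx x 0 i ^+ 2.

(* Main.v *)
From HB Require Import structures.
Require Import Defs.
From mathcomp Require Import all_boot all_order all_algebra all_field.
From mathcomp Require Import reals.

Set Implicit Arguments.
Unset Strict Implicit.
Unset Printing Implicit Defensive.

Import GRing.Theory Num.Theory.
Local Open Scope ring_scope.

(** The proof has an algebraic half, which is about square matrices over the
    tensor product of two non-associative algebras, and a formal half, which
    knows only that some operators satisfy the Clifford relations.

    Clifford relations.  The real numbers apart, every algebra of the list is
    a Cayley-Dickson double, and the double of an associative algebra satisfies
    a^* (a x) = N(a) x = a (a^* x), even when it is not associative itself
    ([cd_left_composition], the octonionic case).  In terms of operators, the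
    left multiplications L(a) and L(a^* ) are inverse to each other up to
    N(a).  On the tensor product, a' (x) a acts on a coordinate matrix M
    by M |-> L(a')^T M L(a) ([tmul_tensl]): the two tensor factors act on
    different sides, hence commute.  So the product of X and its companion
    tilde X, computed with operators, is the scalar N'(a') + N(a) = - det X,
    just as over a commutative ring, and Gamma_L(X)^2 = - det X
    ([Gamma_L_sqr]).

    Universal property.  Let e_1, ..., e_n be operators that anticommute and
    have nonzero scalar squares.  The ordered monomials e_S, for S a set of
    indices, span the algebra generated by the e_i, because
    e_i e_S = c e_(S + i), with S + i the symmetric difference.  The scalar c
    depends only on i, S and the squares ([clifford_mul_monomial]), so it is
    the same in every algebra that contains such a family b.  As soon as the
    e_S are linearly independent, e_S |-> b_S is therefore well defined and
    multiplicative ([extensionM]), and this is the universal property.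

    Independence.  The e_i can fail to have independent monomials: when n is
    odd, the product of all the e_i may be a scalar.  Here this is excluded
    because the matrices Gamma(X) are block off-diagonal: the operator g that
    changes the sign of the lower two rows is an involution that anticommutes
    with all the Gamma_L(X) ([grading_anticomm]).  Then g e_i commutes with
    e_S up to the sign (-1)^[i in S], so that the e_S are simultaneous
    eigenvectors of the conjugations by the g e_i, with pairwise different
    systems of eigenvalues, hence independent ([monomial_indep]). *)

(** * Left composition in Cayley-Dickson algebras *)

HB.instance Definition _ (R : fieldType) (A : star_algebra R) x :=
  GRing.isLinear.Build R _ _ _ (@smul R A x) (smul_linear_r x).

HB.instance Definition _ (R : fieldType) (A : star_algebra R) :=
  GRing.isLinear.Build R _ _ _ (@sconj R A) (@sconj_linear R A).

Section StarAlgebra.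
Variables (R : fieldType) (A : star_algebra R).
Implicit Types (a b x y z : 'rV[R]_(sdim A)) (c : R).

Lemma smulDr x y z : smul x (y + z) = smul x y + smul x z.
Proof. exact: linearD. Qed.
Lemma smulZr c x y : smul x (c *: y) = c *: smul x y.
Proof. exact: linearZ. Qed.
Lemma smulNr x y : smul x (- y) = - smul x y.
Proof. exact: linearN. Qed.
Lemma smulDl x y z : smul (x + y) z = smul x z + smul y z.
Proof. by have := smul_linear_l z 1 x y; rewrite !scale1r. Qed.
Lemma smul0l x : smul 0 x = 0.
Proof. by apply: (addrI (smul 0 x)); rewrite -smulDl !addr0. Qed.
Lemma smulZl c x y : smul (c *: x) y = c *: smul x y.
Proof. by have := smul_linear_l y c x 0; rewrite !addr0 smul0l addr0. Qed.
Lemma smulNl x y : smul (- x) y = - smul x y.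
Proof. by rewrite -!scaleN1r smulZl. Qed.

Lemma sconjD x y : sconj (x + y) = sconj x + sconj y.
Proof. exact: linearD. Qed.
Lemma sconjN x : sconj (- x) = - sconj x.
Proof. exact: linearN. Qed.
Lemma sconjZ c x : sconj (c *: x) = c *: sconj x.
Proof. exact: linearZ. Qed.

(** The part of the theory of the norm that survives every doubling;
    associativity and commutativity, which do not, are tracked apart. *)
Record star_norm (N : 'rV[R]_(sdim A) -> R) : Prop := StarNorm {
  sconjK : involutive (@sconj R A);
  sconjM : forall x y, sconj (smul x y) = smul (sconj y) (sconj x);
  smul_conjr : forall x, smul x (sconj x) = N x *: sone A;
  smul_conjl : forall x, smul (sconj x) x = N x *: sone A
}.

(** L(a) and L(a^* ) are inverse to each other up to the scalar N a.  This
    consequence of alternativity is the only form of associativity that the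
    Clifford relations need. *)
Definition left_composition (N : 'rV[R]_(sdim A) -> R) : Prop :=
  forall a x, smul (sconj a) (smul a x) = N a *: x
           /\ smul a (smul (sconj a) x) = N a *: x.

Lemma eq_star_norm N N' : N =1 N' -> star_norm N -> star_norm N'.
Proof. by move=> eqN [K M l r]; split=> // x; rewrite -eqN. Qed.

Lemma eq_left_composition N N' :
  N =1 N' -> left_composition N -> left_composition N'.
Proof. by move=> eqN NP a x; rewrite -eqN; apply: NP. Qed.

Lemma star_norm_conj N : star_norm N -> forall x, N (sconj x) = N x.
Proof.
move=> [K M r l] x; have := l x; rewrite -{2}[x]K r => /eqP.
by rewrite -subr_eq0 -scalerBl scaler_eq0 (negPf (sone_neq0 A)) orbF subr_eq0 => /eqP.
Qed.

Lemma assoc_left_composition N :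
  associative (@smul R A) -> star_norm N -> left_composition N.
Proof.
move=> smulA NP a x; rewrite !smulA (smul_conjl NP) (smul_conjr NP).
by rewrite smulZl smul1l.
Qed.
End StarAlgebra.

Section Doubling.
Variables (R : fieldType) (g : R) (A : star_algebra R).
Variable N : 'rV[R]_(sdim A) -> R.
Hypothesis NP : star_norm N.
Local Notation D := (cayley_dickson g A).
Local Notation n := (sdim A).

Definition cd_norm (x : 'rV[R]_(n + n)) := N (lsubmx x) - g * N (rsubmx x).

Lemma cd_pairE (a b c d : 'rV[R]_n) :
  @smul R D (row_mx a b) (row_mx c d) =
  row_mx (smul a c + g *: smul (sconj d) b) (smul d a + smul b (sconj c)).
Proof. by rewrite /= /cd_mul !row_mxKl !row_mxKr. Qed.

Lemma cd_conjE (a b : 'rV[R]_n) :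
  @sconj R D (row_mx a b) = row_mx (sconj a) (- b).
Proof. by rewrite /= /cd_conj row_mxKl row_mxKr. Qed.

(** Lets [elim/cd_ind] expose the two halves of an element of the double. *)
Lemma cd_ind (P : 'rV[R]_(sdim D) -> Prop) :
  (forall a b : 'rV[R]_n, P (row_mx a b)) -> forall x, P x.
Proof. by move=> IH x; rewrite -[x](@hsubmxK _ _ n n); apply: IH. Qed.

Lemma cd_star_norm : @star_norm R D cd_norm.
Proof.
split.
- elim/cd_ind=> a b; rewrite !cd_conjE opprK (sconjK NP) //.
- elim/cd_ind=> a b; elim/cd_ind=> c d.
  rewrite !(cd_pairE, cd_conjE) (sconjK NP) sconjN.
  rewrite !smulNl !smulNr opprK sconjD sconjZ !(sconjM NP) (sconjK NP).
  by rewrite opprD [X in row_mx _ X]addrC.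
- elim/cd_ind=> a b.
  rewrite cd_conjE cd_pairE (sconjK NP) sconjN !smulNl (smul_conjr NP).
  rewrite (smul_conjl NP) addNr /cd_norm row_mxKl row_mxKr.
  by rewrite scalerN scalerA -scalerBl /cd_one scale_row_mx scaler0.
- elim/cd_ind=> a b.
  rewrite cd_conjE cd_pairE smulNl smulNr (smul_conjl NP).
  rewrite (smul_conjl NP) subrr /cd_norm row_mxKl row_mxKr.
  by rewrite scalerN scalerA -scalerBl /cd_one scale_row_mx scaler0.
Qed.

Lemma cd_smulC : commutative (@smul R A) -> @sconj R A =1 id ->
  commutative (@smul R D).
Proof.
move=> smulC conj_id; elim/cd_ind=> a b; elim/cd_ind=> c d.
by rewrite !cd_pairE !conj_id (smulC a c) (smulC d b) [X in row_mx _ X]addrC.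
Qed.

Lemma cd_smulA : associative (@smul R A) -> commutative (@smul R A) ->
  associative (@smul R D).
Proof.
move=> smulA smulC; elim/cd_ind=> a b; elim/cd_ind=> c d; elim/cd_ind=> e f.
rewrite !cd_pairE !(sconjD, sconjZ, smulDl, smulDr, smulZl, smulZr, scalerDr).
rewrite !(sconjM NP) !(sconjK NP).
have smulCA x y z : smul x (smul y z) = smul y (smul x z) :> 'rV_(sdim A).
  by rewrite !smulA (smulC x).
congr row_mx.
  rewrite -!addrA -!smulA; congr (_ + _); rewrite addrA addrC.
  rewrite (smulC b e) (smulCA _ e) (smulC d a) (smulCA _ a).
  by rewrite (smulC b) (smulCA _ (sconj c)).
rewrite [X in _ + X]addrC addrACA.
rewrite (smulC _ f) (smulCA b f) (smulC b) -smulA (smulC c a).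
by rewrite -[smul (smul d _) a]smulA (smulC _ a) (smulA d) (smulC (sconj e)) (smulA b).
Qed.

(** Expanding (a, b)^* ((a, b)(c, d)), the terms in which a and b both occur
    cancel in pairs, thanks to the associativity of A; the others are multiples
    of (c, d).  The second identity is the first one at the conjugate, as the
    norm is invariant under conjugation. *)
Lemma cd_left_composition : associative (@smul R A) ->
  @left_composition R D cd_norm.
Proof.
move=> smulA.
have half x y : @smul R D (sconj x) (smul x y) = cd_norm x *: y.
  elim/cd_ind: x => a b; elim/cd_ind: y => c d.
  rewrite cd_conjE !cd_pairE /cd_norm row_mxKl row_mxKr scale_row_mx.
  rewrite !(sconjD, sconjZ, smulNl, smulNr, smulDl, smulDr, smulZr).
  rewrite !(sconjM NP) !(sconjK NP) ?opprD.
  have NlP x y : smul (sconj x) (smul x y) = N x *: y.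
    by rewrite smulA (smul_conjl NP) smulZl smul1l.
  have NrP x y : smul x (smul (sconj x) y) = N x *: y.
    by rewrite smulA (smul_conjr NP) smulZl smul1l.
  rewrite -!smulA !NlP NrP (smul_conjl NP) (smul_conjr NP) !smulZr !smul1r.
  rewrite scalerBr scalerN addrA addrK addrA addrK.
  by rewrite !scalerA -!scalerBl.
move=> x y; split=> //.
have := half (sconj x) y; rewrite (sconjK cd_star_norm) => ->.
by rewrite (star_norm_conj cd_star_norm).
Qed.
End Doubling.

Definition sq_norm (R : fieldType) n (x : 'rV[R]_n) : R := \sum_i x 0 i ^+ 2.

Section Norms.
Variable R : fieldType.
Local Notation real := (real_alg R).

Lemma real_star_norm : @star_norm R real (@sq_norm R 1).
Proof.
have smul_sq (x : 'rV[R]_1) : @smul R real x x = sq_norm x *: sone real.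
  by apply/rowP=> i; rewrite !mxE /sq_norm big_ord1 [i]ord1 expr2 mulr1.
by split=> //= x y; apply/rowP=> i; rewrite !mxE mulrC.
Qed.

Lemma real_smulC : commutative (@smul R real).
Proof. by move=> x y; apply/rowP=> i; rewrite !mxE mulrC. Qed.

Lemma real_smulA : associative (@smul R real).
Proof. by move=> x y z; apply/rowP=> i; rewrite !mxE mulrA. Qed.

Lemma sq_norm_split n (x : 'rV[R]_(n + n)) :
  sq_norm (lsubmx x) - (-1) * sq_norm (rsubmx x) = sq_norm x.
Proof.
rewrite mulN1r opprK /sq_norm big_split_ord.
by congr (_ + _); apply: eq_bigr => i _; rewrite mxE.
Qed.

Lemma double_star_norm (A : star_algebra R) :
  star_norm (A := A) (@sq_norm R _) ->
  @star_norm R (cayley_dickson (-1) A) (@sq_norm R _).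
Proof. by move/(cd_star_norm (-1)); apply: eq_star_norm; exact: sq_norm_split. Qed.

Lemma div_star_norm K : star_norm (A := div_star R K) (@sq_norm R _).
Proof. by case: K; do ?apply: double_star_norm; apply: real_star_norm. Qed.

Lemma div_smulA K : K <> DivO -> associative (@smul R (div_star R K)).
Proof.
have cA : associative (@smul R (div_star R DivC)).
  exact: (cd_smulA real_star_norm real_smulA real_smulC).
have cC : commutative (@smul R (div_star R DivC)).
  by apply: (cd_smulC real_smulC) => x.
case: K => [_|_|_|/(_ erefl)[]].
- exact: real_smulA.
- exact: cA.
- exact: (cd_smulA (div_star_norm DivC) cA cC).
Qed.

Lemma div_left_composition K :
  left_composition (A := div_star R K) (@sq_norm R _).
Proof.
have [->|KnO] : K = DivO \/ K <> DivO by case: K; [right|right|right|left].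
  have assocH : associative (@smul R (div_star R DivH)) by exact: div_smulA.
  apply: eq_left_composition (cd_left_composition (div_star_norm DivH) assocH).
  exact: sq_norm_split.
exact: assoc_left_composition (div_smulA KnO) (div_star_norm K).
Qed.

(** [u] reads a split algebra in coordinates that list the positive directions
    of its norm before the negative ones.  In a double with g = 1 this is
    already the order of the coordinates, and [u] is the identity: only the
    types have to be reconciled. *)
Lemma split_norm K' :
  exists N (u : {linear 'rV[R]_(kappa'_pos K' + kappa'_neg K') ->
                        'rV[R]_(sdim (split_star R K'))}),
    [/\ left_composition N, bijective u & forall x, N (u x) = std_form x].
Proof.
have split_double K : K <> DivO -> let A := div_star R K in exists N (u :
    {linear 'rV[R]_(sdim A + sdim A) -> 'rV[R]_(sdim (cayley_dickson 1 A))}),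
    [/\ left_composition N, bijective u & forall x, N (u x) = std_form x].
  move=> KnO A; exists (cd_norm 1 (@sq_norm R _)), idfun; split.
  - exact: cd_left_composition (div_star_norm K) (div_smulA KnO).
  - by exists idfun.
  - by move=> x; rewrite /cd_norm mul1r.
case: K'; first last.
- exact: (split_double DivH).
- exact: (split_double DivC).
- exact: (split_double DivR).
exists (@sq_norm R 1), (idfun : {linear 'rV[R]_(1 + 0) -> 'rV[R]_1}); split.
- exact: (@div_left_composition DivR).
- by exists idfun.
- move=> x; rewrite /std_form /sq_norm big_ord0 subr0 !big_ord1 mxE.
  by congr (x 0 _ ^+ 2); apply: val_inj.
Qed.

Lemma div_norm K : exists u :
  {linear 'rV[R]_(kappa K) -> 'rV[R]_(sdim (div_star R K))},
  bijective u /\ forall x, sq_norm (u x) = sq_norm x.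
Proof.
by case: K; exists idfun; split=> //; exists idfun.
Qed.
End Norms.

(** * The matrices Gamma(X) satisfy the Clifford relations *)

HB.instance Definition _ (R : fieldType) (A' A : star_algebra R)
  (M : tensor A' A) :=
  GRing.isLinear.Build R _ _ _ (tmul M) (tmul_linear_r M).

Section LeftMultiplication.
Variables (R : fieldType) (A : star_algebra R).
Implicit Types (a x : 'rV[R]_(sdim A)) (N : 'rV[R]_(sdim A) -> R).

(** Left multiplications as matrices acting on row vectors: unlike the elements
    of the algebra, these can be composed associatively. *)
Definition lmul_mx a : 'M[R]_(sdim A) := lin1_mx (smul a).

Lemma mul_lmul_mx a x : x *m lmul_mx a = smul a x.
Proof. exact: mul_rV_lin1. Qed.

Lemma lmul_mx1 : lmul_mx (sone A) = 1%:M.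
Proof. by apply/row_matrixP=> i; rewrite !rowE mul_lmul_mx smul1l mulmx1. Qed.

Lemma lmul_mx_conj N a : left_composition N ->
  lmul_mx a *m lmul_mx (sconj a) = (N a)%:M
  /\ lmul_mx (sconj a) *m lmul_mx a = (N a)%:M.
Proof.
move=> NP; split; apply/row_matrixP=> i;
  by rewrite !rowE mulmxA !mul_lmul_mx mul_mx_scalar; apply NP.
Qed.
End LeftMultiplication.

Section Square.
Variables (R : fieldType) (A' A : star_algebra R).
Variables (N' : 'rV[R]_(sdim A') -> R) (N : 'rV[R]_(sdim A) -> R).
Hypotheses (NP' : left_composition N') (NP : left_composition N).
Implicit Types (b : 'rV[R]_(sdim A')) (a : 'rV[R]_(sdim A)).
Implicit Types (p : 'rV[R]_(sdim A') * 'rV[R]_(sdim A)).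
Implicit Types (M : tensor A' A) (X : kmx A' A 2) (Q : kmx A' A 4).

(** The left factor acts on the rows of a coordinate matrix and the right factor
    on its columns, so that the commutation of the two factors becomes the
    associativity of the product of matrices. *)
Lemma tmul_tensl b a M :
  tmul (tens b a) M = (lmul_mx b)^T *m M *m lmul_mx a.
Proof.
rewrite [M]matrix_sum_delta linear_sum mulmx_sumr mulmx_suml.
apply: eq_bigr => i _; rewrite linear_sum mulmx_sumr mulmx_suml.
apply: eq_bigr => j _; rewrite linearZ -scalemxAr -scalemxAl /=.
rewrite -(mul_delta_mx (0 : 'I_1)) -[delta_mx i 0]trmx_delta tmul_tens.
by rewrite /tens -!mul_lmul_mx trmx_mul !mulmxA.
Qed.

Lemma tmul_tens1r b M : tmul (tens b (sone A)) M = (lmul_mx b)^T *m M.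
Proof. by rewrite tmul_tensl lmul_mx1 mulmx1. Qed.

Lemma tmul_tens1l a M : tmul (tens (sone A') a) M = M *m lmul_mx a.
Proof. by rewrite tmul_tensl lmul_mx1 trmx1 mul1mx. Qed.

Lemma tmul0l M : tmul 0 M = 0.
Proof.
by rewrite /tmul; do 4!(apply: big1 => ? _); rewrite mxE mul0r scale0r.
Qed.

Lemma tmulNl M M' : tmul (- M) M' = - tmul M M'.
Proof.
by have := tmul_linear_l M' (-1) M 0; rewrite tmul0l !addr0 !scaleN1r.
Qed.

Lemma sum2E (V : nmodType) (F : 'I_2 -> V) : \sum_(k < 2) F k = F 0 + F 1.
Proof. by rewrite big_ord_recl big_ord1; congr (_ + F _); apply: val_inj. Qed.

Lemma Gamma_L_top X Q i j : Gamma_L X Q (@lshift 2 2 i) j =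
  \sum_k tmul (X i k) (Q (@rshift 2 2 k) j).
Proof.
rewrite left_mulE mxE (@big_split_ord _ _ _ 2 2) /= big1 ?add0r => [|k _].
  by apply: eq_bigr => k _; rewrite (@block_mxEur _ 2 2 2 2).
by rewrite (@block_mxEul _ 2 2 2 2) mxE tmul0l.
Qed.

Lemma Gamma_L_bottom X Q i j : Gamma_L X Q (@rshift 2 2 i) j =
  \sum_k tmul (tilde X i k) (Q (@lshift 2 2 k) j).
Proof.
rewrite left_mulE mxE (@big_split_ord _ _ _ 2 2) /= addrC big1 ?add0r => [|k _].
  by apply: eq_bigr => k _; rewrite (@block_mxEdl _ 2 2 2 2).
by rewrite (@block_mxEdr _ 2 2 2 2) mxE tmul0l.
Qed.

(** Subtracting the trace exchanges the diagonal entries up to sign: it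
    conjugates the entry from A' and leaves the one from A alone. *)
Lemma tilde_V2_mx p : tilde (V2_mx p) =
  mx22 (tens (sconj p.1) (sone A)) (tens (sone A') (sconj p.2))
       (tens (sone A') p.2) (- tens p.1 (sone A)).
Proof.
apply/matrixP=> i j; rewrite /tilde /mxtrace sum2E !mxE /=.
case: i => -[|[|//]] /= i2; case: j => -[|[|//]] /= j2.
- by rewrite mulr1n opprB addrC subrK.
- by rewrite mulr0n subr0.
- by rewrite mulr0n subr0.
- by rewrite mulr1n opprB addKr.
Qed.

Lemma V2_mx_actE p (y : 'I_2 -> tensor A' A) :
  let z i := \sum_k tmul (V2_mx p i k) (y k) in
  let w i := \sum_k tmul (tilde (V2_mx p) i k) (y k) in
  [/\ z 0 = (lmul_mx p.1)^T *m y 0 + y 1 *m lmul_mx (sconj p.2),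
      z 1 = y 0 *m lmul_mx p.2 - (lmul_mx (sconj p.1))^T *m y 1,
      w 0 = (lmul_mx (sconj p.1))^T *m y 0 + y 1 *m lmul_mx (sconj p.2)
    & w 1 = y 0 *m lmul_mx p.2 - (lmul_mx p.1)^T *m y 1].
Proof.
move=> z w; rewrite {}/z {}/w tilde_V2_mx.
by rewrite !sum2E !mxE /= !tmulNl !tmul_tens1r !tmul_tens1l.
Qed.

(** The identity X tilde(X) = tilde(X) X = - det X, at the level of operators on
    columns: for b in A' and a in A, the off-diagonal terms b a y - a b y vanish by
    commutation of the two factors, and the diagonal ones are norms by left composition. *)
Lemma V2_mx_tilde_act p (y : 'I_2 -> tensor A' A) i :
  \sum_k tmul (V2_mx p i k) (\sum_l tmul (tilde (V2_mx p) k l) (y l))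
    = (N' p.1 + N p.2) *: y i
  /\ \sum_k tmul (tilde (V2_mx p) i k) (\sum_l tmul (V2_mx p k l) (y l))
    = (N' p.1 + N p.2) *: y i.
Proof.
pose w k := \sum_l tmul (tilde (V2_mx p) k l) (y l).
pose z k := \sum_l tmul (V2_mx p k l) (y l).
have [wz0 wz1 _ _] := V2_mx_actE p w.
have [_ _ zw0 zw1] := V2_mx_actE p z.
have [z0 z1 w0 w1] := V2_mx_actE p y.
have [N1 N2] := lmul_mx_conj p.2 NP.
have [N1' N2'] := lmul_mx_conj p.1 NP'.
have i01 : i = 0 \/ i = 1.
  by case: i => -[|[|//]] i2; [left|right]; apply: val_inj.
change (\sum_k tmul (V2_mx p i k) (w k) = (N' p.1 + N p.2) *: y i
  /\ \sum_k tmul (tilde (V2_mx p) i k) (z k) = (N' p.1 + N p.2) *: y i).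
rewrite -/(z 0) -/(z 1) -/(w 0) -/(w 1) in z0 z1 w0 w1.
have {}N1' M : (lmul_mx (sconj p.1))^T *m ((lmul_mx p.1)^T *m M) = N' p.1 *: M.
  by rewrite mulmxA -trmx_mul N1' tr_scalar_mx mul_scalar_mx.
have {}N2' M : (lmul_mx p.1)^T *m ((lmul_mx (sconj p.1))^T *m M) = N' p.1 *: M.
  by rewrite mulmxA -trmx_mul N2' tr_scalar_mx mul_scalar_mx.
have {}N1 M : M *m lmul_mx p.2 *m lmul_mx (sconj p.2) = N p.2 *: M.
  by rewrite -mulmxA N1 mul_mx_scalar.
have {}N2 M : M *m lmul_mx (sconj p.2) *m lmul_mx p.2 = N p.2 *: M.
  by rewrite -mulmxA N2 mul_mx_scalar.
case: i01 => ->.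
  rewrite wz0 zw0 w0 w1 z0 z1 !(mulmxDl, mulmxDr, mulNmx, mulmxN).
  rewrite N1 N1' N2' !mulmxA scalerDl.
  by split; rewrite addrACA subrr addr0.
rewrite wz1 zw1 w0 w1 z0 z1 !(mulmxDl, mulmxDr, mulNmx, mulmxN).
rewrite N2 N1' N2' !mulmxA scalerDl.
by split; rewrite opprB addrC addrA subrK.
Qed.

Lemma Gamma_L_sqr p :
  Gamma_L (V2_mx p) * Gamma_L (V2_mx p) = (N' p.1 + N p.2)%:A :> kend A' A.
Proof.
apply/lfunP=> Q; rewrite kend_mulE scale_lfunE id_lfunE.
apply/matrixP=> i j; rewrite [RHS]mxE.
case: (@split_ordP 2 2 i) => k ->.
  rewrite Gamma_L_top -(V2_mx_tilde_act _ (fun k => Q (@lshift 2 2 k) j) _).1.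
  by apply: eq_bigr => l _; rewrite Gamma_L_bottom.
rewrite Gamma_L_bottom -(V2_mx_tilde_act _ (fun k => Q (@rshift 2 2 k) j) _).2.
by apply: eq_bigr => l _; rewrite Gamma_L_top.
Qed.

(** Multiplication by diag(1, 1, -1, -1). *)
Definition grading_fun Q : kmx A' A 4 :=
  \matrix_(i, j) if (i < 2)%N then Q i j else - Q i j.

Lemma grading_fun_linear : linear grading_fun.
Proof.
move=> c P Q; apply/matrixP=> i j; rewrite !mxE.
by case: ifP => _ //; rewrite opprD scalerN.
Qed.

HB.instance Definition _ :=
  GRing.isLinear.Build R _ _ _ grading_fun grading_fun_linear.

Definition grading : kend A' A := linfun grading_fun.

Lemma grading_sqr : grading * grading = 1.
Proof.
apply/lfunP=> Q; rewrite kend_mulE id_lfunE !lfunE /=.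
by apply/matrixP=> i j; rewrite !mxE; case: (i < 2)%N; rewrite ?opprK.
Qed.

Lemma grading_anticomm X : grading * Gamma_L X = - (Gamma_L X * grading).
Proof.
apply/lfunP=> Q; rewrite opp_lfunE !kend_mulE.
apply/matrixP=> i j; rewrite [RHS]mxE lfunE [LHS]mxE.
case: (@split_ordP 2 2 i) => k -> /=.
  rewrite !Gamma_L_top -sumrN; apply: eq_bigr => l _.
  by rewrite lfunE /= [grading_fun _ _ _]mxE /= linearN opprK.
rewrite !Gamma_L_bottom -sumrN -[RHS]sumrN; apply: eq_bigr => l _.
by rewrite lfunE /= [grading_fun _ _ _]mxE /= ltn_ord.
Qed.

Lemma tens_eq0l b a : a != 0 -> tens b a = 0 -> b = 0.
Proof.
move=> /rV0Pn[j a_j] /matrixP ba0; apply/rowP=> i; have := ba0 i j.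
rewrite !mxE big_ord1 !mxE => /eqP.
by rewrite mulf_eq0 (negPf a_j) orbF => /eqP.
Qed.

Lemma tens_eq0r b a : b != 0 -> tens b a = 0 -> a = 0.
Proof.
move=> /rV0Pn[i b_i] /matrixP ba0; apply/rowP=> j; have := ba0 i j.
rewrite !mxE big_ord1 !mxE => /eqP.
by rewrite mulf_eq0 (negPf b_i) => /eqP.
Qed.

Lemma scalar_ofZ c : scalar_of (c *: tone A' A) = c.
Proof.
rewrite /scalar_of linearZ /= (coord_free 0) ?mulr1 //.
rewrite seq1_free; apply: contraNneq (sone_neq0 A') => /tens_eq0l -> //.
exact: sone_neq0.
Qed.

Lemma V2_form_mx p : V2_form (V2_mx p) = N' p.1 + N p.2.
Proof.
have tL (b b2 : 'rV[R]_(sdim A')) :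
    tmul (tens b (sone A)) (- tens b2 (sone A)) = - tens (smul b b2) (sone A).
  by rewrite linearN /= tmul_tens smul1l.
rewrite /V2_form /kdet2 !mxE /= tL tmul_tens smul1l.
have := (NP' p.1 (sone A')).2; have := (NP p.2 (sone A)).1.
rewrite !smul1r => -> ->; rewrite /tens linearZ /= -scalemxAl -scalemxAr.
by rewrite -opprD -scalerDl opprK scalar_ofZ.
Qed.

Lemma V2_mx_inj : injective (@V2_mx R A' A).
Proof.
move=> p q /eqP; rewrite -subr_eq0 -linearB => /eqP/matrixP pq0.
apply/eqP; rewrite -subr_eq0; apply/eqP.
have := pq0 0 0; have := pq0 1 0; rewrite !mxE /=.
move=> /(tens_eq0r (sone_neq0 A')) p2 /(tens_eq0l (sone_neq0 A)) p1.
rewrite [p - q]surjective_pairing; exact: f_equal2 p1 p2.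
Qed.

End Square.

(** * Monomials in a family of anticommuting elements *)

Section Monomials.
Variables (R : fieldType) (n : nat) (d : 'I_n -> R).

Definition clifford_family (B : algType R) (b : 'I_n -> B) : Prop :=
  (forall i, b i * b i = (d i)%:A)
  /\ (forall i j, i != j -> b i * b j = - (b j * b i)).

Definition monomial (B : algType R) (b : 'I_n -> B) (S : {set 'I_n}) : B :=
  \prod_(i in S) b i.

(** The coefficient that appears when b i is moved into its place in an ordered
    monomial: a sign for each generator that it crosses, and d i if it meets
    itself. *)
Fixpoint toggle_coef (i : 'I_n) (P : pred 'I_n) (r : seq 'I_n) : R :=
  if r is j :: r' then
    if j == i then (if P i then d i else 1)
    else (-1) ^+ P j * toggle_coef i P r'
  else 1.

(** Stated for a sequence and a predicate, and not for a set, so that the ordered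
    product can be treated by induction. *)
Lemma clifford_mul_prod (B : algType R) (b : 'I_n -> B) i P r :
    clifford_family b -> uniq r -> i \in r ->
  b i * \prod_(j <- r | P j) b j =
  toggle_coef i P r *: \prod_(j <- r | P j (+) (j == i)) b j.
Proof.
move=> [b_sqr b_anti]; elim: r => //= k r IHr /andP[k_r r_uniq].
rewrite in_cons !big_cons eq_sym; have [-> _|ki /= i_r] := eqVneq i k.
  have -> : \prod_(j <- r | P j (+) (j == k)) b j = \prod_(j <- r | P j) b j.
    rewrite big_seq_cond [RHS]big_seq_cond; apply: eq_bigl => j.
    by case: eqP => [->|]; rewrite ?(negPf k_r) // addbF.
  rewrite addbT; case: (P k); rewrite /= ?scale1r //.
  by rewrite mulrA b_sqr mulr_algl.
rewrite addbF; case: (P k) => /=; last by rewrite mul1r IHr.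
by rewrite mulrA b_anti // mulNr -mulrA IHr // -scalerAr expr1 mulN1r scaleNr.
Qed.

Definition toggle (i : 'I_n) (S : {set 'I_n}) := [set j | (j \in S) (+) (j == i)].

(** The order of the quantifiers is the point: one scalar c serves all algebras,
    so that two Clifford families for the same d have the same multiplication
    table. *)
Lemma clifford_mul_monomial i S : exists c : R,
  forall (B : algType R) (b : 'I_n -> B), clifford_family b ->
    b i * monomial b S = c *: monomial b (toggle i S).
Proof.
exists (toggle_coef i (mem S) (index_enum 'I_n)) => B b b_cl.
rewrite /monomial clifford_mul_prod ?index_enum_uniq ?mem_index_enum //.
by congr (_ *: _); apply: eq_bigl => j; rewrite inE.
Qed.

Section Free.
Variables (B : algType R) (b : 'I_n -> B) (g : B).
Hypotheses (two_neq0 : 2%:R != 0 :> R) (d_neq0 : forall i, d i != 0).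
Hypotheses (b_cl : clifford_family b) (g_sqr : g * g = 1).
Hypothesis g_anti : forall i, g * b i = - (b i * g).

(** b i alone commutes with a monomial up to a sign that depends on the parity of
    its degree; the factor g corrects for this parity, and the remaining sign
    detects the membership of i in S. *)
Lemma twisted_commute i S :
  g * b i * monomial b S = (-1) ^+ (i \in S) *: (monomial b S * (g * b i)).
Proof.
have [b_sqr b_anti] := b_cl.
have step j : g * b i * b j = (-1) ^+ (j == i) *: (b j * (g * b i)).
  have [->|ji] := eqVneq j i.
    by rewrite expr1 scaleN1r mulrA -mulNr -g_anti.
  have ij : i != j by rewrite eq_sym.
  rewrite scale1r -mulrA (b_anti _ _ ij) mulrN.
  by rewrite [in LHS]mulrA (g_anti j) mulNr opprK mulrA.
have -> : (-1) ^+ (i \in S) = \prod_(j in S) (-1) ^+ (j == i) :> R.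
  have [iS|iS] := boolP (i \in S).
    rewrite (bigD1 i) //= eqxx big1 ?mulr1 // => j /andP[_ /negPf ->] //.
  by rewrite big1 // => j jS; case: eqP iS => // <-; rewrite jS.
rewrite /monomial; elim: (index_enum _) => [|j r IHr].
  by rewrite !big_nil scale1r mul1r mulr1.
rewrite !big_cons; case: (j \in S) => //.
rewrite [in LHS]mulrA step -[in LHS]scalerAl -[in LHS]mulrA IHr.
by rewrite -scalerAr scalerA !mulrA.
Qed.

Lemma twist_reg i x : x * (g * b i) = 0 -> x = 0.
Proof.
move=> xgb; have [b_sqr _] := b_cl.
have: x * (g * b i) * (b i * g) = 0 by rewrite xgb mul0r.
rewrite -!mulrA (mulrA (b i)) b_sqr mulr_algl -scalerAr g_sqr -scalerAr mulr1.
by move/eqP; rewrite scaler_eq0 (negPf (d_neq0 i)) => /eqP.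
Qed.

Lemma monomial_reg x S : x * monomial b S = 0 -> x = 0.
Proof.
have [b_sqr _] := b_cl.
rewrite /monomial; elim: (index_enum _) x => [|j r IHr] x.
  by rewrite big_nil mulr1.
rewrite big_cons; case: (j \in S); last exact: IHr.
rewrite mulrA => /IHr xb; have: x * b j * b j = 0 by rewrite xb mul0r.
rewrite -mulrA b_sqr -scalerAr mulr1 => /eqP.
by rewrite scaler_eq0 (negPf (d_neq0 j)) => /eqP.
Qed.

(** In a vanishing combination, the terms for which S and T agree at a given index
    i form an eigenvector of the conjugation by g * b i, and the others form one
    for the opposite eigenvalue; hence each part vanishes.  Treating all indices
    in turn isolates the term of T. *)
Lemma monomial_indep (c : {set 'I_n} -> R) :
  \sum_S c S *: monomial b S = 0 -> forall S, c S = 0.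
Proof.
move=> sum0 T.
have agree0 r :
    \sum_(S : {set 'I_n} | all (fun i => (i \in S) == (i \in T)) r) c S *: monomial b S = 0.
  elim: r => [|i r IHr] /=; first exact: sum0.
  move: IHr; rewrite (bigID (fun S : {set 'I_n} => (i \in S) == (i \in T))) /=.
  rewrite (eq_bigl (fun S : {set 'I_n} => ((i \in S) == (i \in T))
    && all (fun i => (i \in S) == (i \in T)) r)); last by move=> S; rewrite andbC.
  set same := \sum_(S | _) _; set diff := \sum_(S | _ && ~~ _) _ => sum_r.
  have twist_same : g * b i * same = (-1) ^+ (i \in T) *: (same * (g * b i)).
    rewrite mulr_sumr mulr_suml scaler_sumr; apply: eq_bigr => S /andP[/eqP iS _].
    by rewrite -scalerAr twisted_commute iS -scalerAl !scalerA mulrC.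
  have twist_diff : g * b i * diff = - (-1) ^+ (i \in T) *: (diff * (g * b i)).
    rewrite mulr_sumr mulr_suml scaler_sumr; apply: eq_bigr => S /andP[_ iS].
    rewrite -scalerAr twisted_commute -scalerAl !scalerA mulrC; congr (_ * _ *: _).
    by move: iS; do 2!case: (_ \in _); rewrite //= ?opprK.
  have: g * b i * (same + diff) = 0 by rewrite sum_r mulr0.
  have diffE : diff = - same by apply/eqP; rewrite -addr_eq0 addrC sum_r.
  rewrite mulrDr twist_same twist_diff diffE mulNr scaleNr scalerN opprK.
  rewrite -scalerDl -mulr2n -mulr_natl => /eqP.
  rewrite scaler_eq0 mulf_eq0 (negPf two_neq0) signr_eq0 => /eqP.
  exact: twist_reg.
have := agree0 (enum 'I_n).
rewrite (big_pred1 T) => [|S]; last first.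
  apply/allP/eqP => [ST|-> //]; apply/setP=> i.
  by apply/eqP/ST; rewrite mem_enum.
rewrite -[monomial b T]mul1r => /eqP; rewrite scalerAl => /eqP/monomial_reg/eqP.
by rewrite scaler_eq0 oner_eq0 orbF => /eqP.
Qed.
End Free.
End Monomials.

(** * The universal property of diagonal forms *)

Section DiagonalForm.
Variables (R : fieldType) (n : nat) (d : 'I_n -> R) (q : 'rV[R]_n -> R).
Hypothesis qE : forall x, q x = \sum_i d i * x 0 i ^+ 2.

Local Notation std i := (delta_mx (0 : 'I_1) (i : 'I_n) : 'rV[R]_n).

Lemma diag_form_delta i : q (std i) = d i.
Proof.
rewrite qE (bigD1 i) //= big1 => [|j /negPf ji]; first last.
  by rewrite mxE ji andbF expr0n mulr0.
by rewrite mxE !eqxx expr1n mulr1 addr0.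
Qed.

Lemma diag_form_delta2 i j : i != j -> q (std i + std j) = d i + d j.
Proof.
move=> ij; rewrite qE (bigD1 i) //= (bigD1 j) 1?eq_sym //= big1 => [|k]; last first.
  by move=> /andP[/negPf ki /negPf kj]; rewrite !mxE ki kj !andbF addr0 expr0n mulr0.
rewrite !mxE !eqxx /= (negPf ij) eq_sym (negPf ij) /=.
by rewrite !addr0 add0r !expr1n !mulr1.
Qed.

(** Two different basis vectors are orthogonal for a diagonal form, so their
    images anticommute: this is the polarization of [f_sqr]. *)
Lemma diag_clifford_family (B : algType R) (f : {linear 'rV[R]_n -> B}) :
  (forall v, f v * f v = (q v)%:A) -> clifford_family d (fun i => f (std i)).
Proof.
move=> f_sqr; split=> [i|i j ij]; first by rewrite f_sqr diag_form_delta.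
have := f_sqr (std i + std j); rewrite diag_form_delta2 // linearD /=.
rewrite mulrDl !mulrDr !f_sqr !diag_form_delta scalerDl.
rewrite addrACA addrA -[RHS]addr0 => /eqP.
rewrite -[X in X == _]addrA -addrA.
rewrite addr0 (inj_eq (addrI _)) addrA -subr_eq0 addrK addrC addr_eq0.
by move/eqP.
Qed.
End DiagonalForm.

Section Universal.
Variables (R : fieldType) (n : nat) (d : 'I_n -> R).
Variables (aT : falgType R) (e : 'I_n -> aT).
Hypothesis e_cl : clifford_family d e.
Hypothesis e_free : forall c : {set 'I_n} -> R,
  \sum_S c S *: monomial e S = 0 -> forall S, c S = 0.

Definition monomials : #|{set 'I_n}|.-tuple aT :=
  [tuple monomial e (enum_val i) | i < #|{set 'I_n}|].

(** The coordinates are functions on the whole algebra aT, so that they are linear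
    without any condition; they are meaningful on the span of the monomials. *)
Definition mcoord (S : {set 'I_n}) (x : aT) : R :=
  coord monomials (enum_rank S) x.

Lemma monomialsE S : monomials`_(enum_rank S) = monomial e S.
Proof. by rewrite -tnth_nth tnth_mktuple enum_rankK. Qed.

Lemma mem_monomial S : monomial e S \in <<monomials>>%VS.
Proof. by rewrite -monomialsE memv_span // mem_nth // size_tuple. Qed.

Lemma sum_enum_rank (V : nmodType) (F : 'I_#|{set 'I_n}| -> V) :
  \sum_i F i = \sum_S F (enum_rank S).
Proof. exact: reindex (onW_bij _ (@enum_rank_bij _)). Qed.

Lemma mcoord_span x : x \in <<monomials>>%VS ->
  x = \sum_S mcoord S x *: monomial e S.
Proof.
move=> /coord_span {1}->; rewrite sum_enum_rank.
by apply: eq_bigr => S _; rewrite monomialsE.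
Qed.

Lemma mcoord_monomial S T : mcoord S (monomial e T) = (S == T)%:R.
Proof.
rewrite /mcoord -monomialsE coord_free ?(inj_eq enum_rank_inj) 1?eq_sym //.
apply/freeP => k; rewrite sum_enum_rank => k0 i.
rewrite -[i]enum_valK; apply: (e_free (c := fun S => k (enum_rank S))).
by rewrite -{2}k0; apply: eq_bigr => U _; rewrite monomialsE.
Qed.

Lemma monomial0 (B : algType R) (b : 'I_n -> B) : monomial b set0 = 1.
Proof. by rewrite /monomial big_set0. Qed.

Lemma monomial1 (B : algType R) (b : 'I_n -> B) i : monomial b [set i] = b i.
Proof. by rewrite /monomial big_set1. Qed.

Lemma mem_gen_mul i x : x \in <<monomials>>%VS -> e i * x \in <<monomials>>%VS.
Proof.
move=> /mcoord_span ->; rewrite mulr_sumr rpred_sum // => S _.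
have [c cP] := clifford_mul_monomial d i S.
by rewrite -scalerAr cP // !rpredZ // mem_monomial.
Qed.

Section Extension.
Variables (B : algType R) (b : 'I_n -> B).
Hypothesis b_cl : clifford_family d b.

Definition extension (x : aT) : B := \sum_S mcoord S x *: monomial b S.

Lemma extension_linear : linear extension.
Proof.
move=> c x y; rewrite /extension scaler_sumr -big_split; apply: eq_bigr => S _.
by rewrite /mcoord linearP scalerDl scalerA.
Qed.

HB.instance Definition _ :=
  GRing.isLinear.Build R _ _ _ extension extension_linear.

Lemma extension_monomial S : extension (monomial e S) = monomial b S.
Proof.
rewrite /extension (bigD1 S) //= big1 => [|T /negPf TS].
  by rewrite mcoord_monomial eqxx scale1r addr0.
by rewrite mcoord_monomial TS scale0r.
Qed.

(** Left multiplication by a generator is given by the same table in both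
    algebras. *)
Lemma extension_gen_mul i x : x \in <<monomials>>%VS ->
  extension (e i * x) = b i * extension x.
Proof.
move=> /mcoord_span ->; rewrite mulr_sumr !linear_sum mulr_sumr.
apply: eq_bigr => S _; rewrite -scalerAr !linearZ /= -scalerAr extension_monomial.
have [c cP] := clifford_mul_monomial d i S.
by rewrite !cP // linearZ /= extension_monomial.
Qed.

Lemma extensionM x y : x \in <<monomials>>%VS -> y \in <<monomials>>%VS ->
  extension (x * y) = extension x * extension y.
Proof.
move=> /mcoord_span -> yX; rewrite mulr_suml !linear_sum mulr_suml.
apply: eq_bigr => S _; rewrite -scalerAl !linearZ /= -scalerAl extension_monomial.
congr (_ *: _); rewrite /monomial.
suff [] : extension (\prod_(i in S) e i * y) = \prod_(i in S) b i * extension y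
  /\ \prod_(i in S) e i * y \in <<monomials>>%VS by [].
elim: (index_enum _) => [|i r [IHr memr]]; first by rewrite !big_nil !mul1r.
rewrite !big_cons; case: (i \in S) => //.
by rewrite -!mulrA mem_gen_mul // extension_gen_mul // IHr.
Qed.

Lemma extension1 : extension 1 = 1.
Proof. by rewrite -(monomial0 e) extension_monomial monomial0. Qed.
End Extension.

Lemma agenv_monomials (U : {vspace aT}) :
  (forall u, u \in U -> exists c, u = \sum_i c i *: e i) ->
  (<<U>>%AS <= <<monomials>>)%VS.
Proof.
move=> U_gen; apply: agenv_sub_modl.
  by rewrite -memvE -(monomial0 e) mem_monomial.
apply/prodvP => u v /U_gen[c ->] vX; rewrite mulr_suml rpred_sum // => i _.
by rewrite -scalerAl rpredZ // mem_gen_mul.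
Qed.
End Universal.

Section DiagonalClifford.
Variables (R : fieldType) (n : nat) (d : 'I_n -> R) (q : 'rV[R]_n -> R).
Hypothesis qE : forall x, q x = \sum_i d i * x 0 i ^+ 2.
Hypotheses (two_neq0 : 2%:R != 0 :> R) (d_neq0 : forall i, d i != 0).
Variables (aT : falgType R) (U : {vspace aT}) (g : aT).
Variable j : {linear 'rV[R]_n -> subvs_of <<U>>%AS}.
Hypothesis j_sqr : forall x, vsval (j x) * vsval (j x) = (q x)%:A.
Hypothesis j_gen : forall u, u \in U -> exists x, u = vsval (j x).
Hypotheses (g_sqr : g * g = 1).
Hypothesis g_anti : forall x, g * vsval (j x) = - (vsval (j x) * g).

(** The involution [g] is only asked to live in the ambient algebra: it may lie
    outside the generated one. *)
Lemma diag_clifford : is_clifford q j.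
Proof.
pose e i := vsval (j (delta_mx 0 i)).
(* The unit of [subvs_of] is the identity element of the subspace, which could
   a priori be a proper idempotent of aT. *)
have val1 : vsval (1 : subvs_of <<U>>%AS) = 1.
  by apply/eqP; rewrite algid_eq1 memvE sub1_agenv.
have e_cl : clifford_family d e.
  exact: (diag_clifford_family qE (f := vsval \o j)).
have e_free := monomial_indep two_neq0 d_neq0 e_cl g_sqr (fun i => g_anti _).
have sub_span : (<<U>>%AS <= <<monomials e>>)%VS.
  apply: (agenv_monomials e_cl) => u /j_gen[x ->]; exists (x 0).
  by rewrite {1}[x]row_sum_delta !linear_sum; apply: eq_bigr => i _; rewrite !linearZ.
have mem_span (x : subvs_of <<U>>%AS) : vsval x \in <<monomials e>>%VS.
  exact: subvP sub_span _ (subvsP x).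
split=> [v|B f f_sqr].
  by apply: val_inj; rewrite /= j_sqr; congr (_ *: _).
have b_cl := diag_clifford_family qE f_sqr.
set b := fun i => _ in b_cl.
pose phi (x : subvs_of <<U>>%AS) := extension e b (vsval x).
have phi_lin : linear phi by move=> c x y; rewrite /phi !linearP.
have phi_mul : GRing.monoid_morphism phi.
  split; first by rewrite /phi val1 (extension1 e_free).
  by move=> x y; rewrite /phi -(extensionM e_cl e_free b_cl).
pose phiL : {lrmorphism _ -> _} := HB.pack phi
  (GRing.isLinear.Build _ _ _ _ phi phi_lin)
  (GRing.isMonoidMorphism.Build _ _ phi phi_mul).
exists phiL; split=> [v|psi psi_j x].
  rewrite [v]row_sum_delta !linear_sum; apply: eq_bigr => i _; rewrite !linearZ /=.
  congr (_ *: _); rewrite /phi -/(e i) -(monomial1 e).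
  by rewrite (extension_monomial e_free) monomial1.
have val_monomial S :
    vsval (monomial (fun i => j (delta_mx 0 i)) S) = monomial e S.
  rewrite /monomial; elim: (index_enum _) => [|i r IHr]; first by rewrite !big_nil.
  by rewrite !big_cons; case: (i \in S); rewrite //= IHr.
have {1}-> : x = \sum_S mcoord e S (vsval x) *: monomial (fun i => j (delta_mx 0 i)) S.
  apply: val_inj; rewrite /= [LHS](mcoord_span (mem_span x)) linear_sum.
  by apply: eq_bigr => S _; rewrite linearZ /= val_monomial.
rewrite linear_sum; apply: eq_bigr => S _; rewrite linearZ /= rmorph_prod.
by congr (_ *: _); apply: eq_bigr => i _; exact: psi_j.
Qed.
End DiagonalClifford.

Lemma is_clifford_transport (R : fieldType) (V W : lmodType R) (q : V -> R)
    (C : algType R) (j : {linear V -> C}) (h : {linear W -> V}) :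
  bijective h -> is_clifford (q \o h) (j \o h) -> is_clifford q j.
Proof.
move=> [k hK kK] [j_sqr univ]; split=> [v|B f f_sqr].
  by have := j_sqr (k v); rewrite /= kK.
have [w|phi [phi_j phi_uniq]] := univ B (f \o h); first exact: f_sqr.
exists phi; split=> [v|psi psi_j]; first by have := phi_j (k v); rewrite /= kK.
by apply: phi_uniq => w; apply: psi_j.
Qed.

(** * The Clifford algebra of V4 *)

Definition std_sign (R : fieldType) (p m : nat) (i : 'I_(p + m)) : R :=
  if split i then 1 else -1.

Lemma std_formE (R : fieldType) p m (x : 'rV[R]_(p + m)) :
  std_form x = \sum_i std_sign R i * x 0 i ^+ 2.
Proof.
rewrite big_split_ord /std_form -sumrN /std_sign.
by congr (_ + _); apply: eq_bigr => i _; rewrite mxE;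
  [rewrite (unsplitK (inl i)) mul1r | rewrite (unsplitK (inr i)) mulN1r].
Qed.

Section CliffordV4.
Variables (R : fieldType) (A' A : star_algebra R) (k p m : nat).
Variables (N' : 'rV[R]_(sdim A') -> R) (N : 'rV[R]_(sdim A) -> R).
Variables (u' : {linear 'rV[R]_(p + m) -> 'rV[R]_(sdim A')})
          (u : {linear 'rV[R]_k -> 'rV[R]_(sdim A)}).
Hypothesis two_neq0 : 2%:R != 0 :> R.
Hypotheses (NP' : left_composition N') (NP : left_composition N).
Hypotheses (u'_bij : bijective u') (u_bij : bijective u).
Hypotheses (u'E : forall x, N' (u' x) = std_form x).
Hypotheses (uE : forall x, N (u x) = sq_norm x).

(** First the coordinates in A, then the positive and at last the negative
    directions of A': the order of the signs in the standard form. *)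
Definition V2_coord (x : 'rV[R]_(k + p + m)) :
    'rV[R]_(sdim A') * 'rV[R]_(sdim A) :=
  (u' (row_mx (rsubmx (lsubmx x)) (rsubmx x)), u (lsubmx (lsubmx x))).

Lemma V2_coord_linear : linear V2_coord.
Proof.
move=> c x y; rewrite /V2_coord !linearP /= -add_row_mx -scale_row_mx.
by rewrite !linearP.
Qed.

HB.instance Definition _ := GRing.isLinear.Build R _ _ _ V2_coord V2_coord_linear.

Lemma V2_coord_bij : bijective V2_coord.
Proof.
have [v' uK' vK'] := u'_bij; have [v uK vK] := u_bij.
exists (fun y => row_mx (row_mx (v y.2) (lsubmx (v' y.1))) (rsubmx (v' y.1))).
  by move=> x; rewrite /V2_coord /= uK uK' row_mxKl row_mxKr !hsubmxK.
move=> [y' y]; rewrite /V2_coord /= !(row_mxKl, row_mxKr) hsubmxK.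
by rewrite vK vK'.
Qed.

Lemma V2_coord_form x : V2_form (V2_mx (V2_coord x)) = std_form x.
Proof.
rewrite (V2_form_mx NP' NP) /= u'E uE /std_form /sq_norm row_mxKl row_mxKr.
rewrite big_split_ord addrC addrA; congr (_ + _ - _).
  by apply: eq_bigr => i _; rewrite mxE.
by apply: eq_bigr => i _; rewrite mxE.
Qed.

Definition V4_coord (x : 'rV[R]_(k + p + m)) : subvs_of (V4 A' A) :=
  vsproj (V4 A' A) (Gamma_L (V2_mx (V2_coord x))).

Lemma V4_coord_linear : linear V4_coord.
Proof. by move=> c x y; rewrite /V4_coord !linearP. Qed.

HB.instance Definition _ := GRing.isLinear.Build R _ _ _ V4_coord V4_coord_linear.

Lemma mem_V4 y : Gamma_L (V2_mx y) \in V4 A' A.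
Proof.
rewrite -[Gamma_L _]lfunE -[V2_mx _]lfunE.
by rewrite /V4 /V2 !memv_img ?memvf.
Qed.

Lemma V4_coordE x : vsval (V4_coord x) = Gamma_L (V2_mx (V2_coord x)).
Proof. by rewrite vsprojK ?mem_V4. Qed.

Lemma V4_mem_coord w : w \in V4 A' A -> exists x, w = vsval (V4_coord x).
Proof.
move=> /memv_imgP[X /memv_imgP[y _ ->] ->]; have [h _ hK] := V2_coord_bij.
by exists (h y); rewrite V4_coordE hK !lfunE.
Qed.

Lemma V4_coord_bij : bijective V4_coord.
Proof.
have inj : injective V4_coord.
  move=> x y xy; apply: (bij_inj V2_coord_bij); apply: V2_mx_inj.
  by apply: Gamma_L_inj; rewrite -!V4_coordE xy.
have surj w : exists x, V4_coord x == w.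
  have [x wx] := V4_mem_coord (subvsP w).
  by exists x; apply/eqP/val_inj.
exists (fun w => xchoose (surj w)) => [x|w]; last exact/eqP/(xchooseP (surj w)).
exact/inj/eqP/(xchooseP (surj _)).
Qed.

Lemma V4_coord_form x : V4_form (V4_coord x) = std_form x.
Proof.
rewrite -V2_coord_form -(V4_formE (mem_V4 (V2_coord x))); congr V4_form.
by apply: val_inj; rewrite /= vsprojK ?mem_V4.
Qed.

Lemma V4_clifford_std :
  is_clifford (@std_form R (k + p) m) (@V4_incl R A' A \o V4_coord).
Proof.
apply: (@diag_clifford _ _ _ _ (@std_formE _ _ _) two_neq0 _ _ _ (grading A' A)).
- by move=> i; rewrite /std_sign; case: (split i) => a; rewrite ?oppr_eq0 oner_eq0.
- by move=> x; rewrite /= V4_coordE (Gamma_L_sqr NP' NP) -V2_coord_form (V2_form_mx NP' NP).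
- by move=> w /V4_mem_coord.
- exact: grading_sqr.
- by move=> x; rewrite /= V4_coordE grading_anticomm.
Qed.

Lemma V4_clifford : is_clifford (@V4_form R A' A) (@V4_incl R A' A).
Proof.
apply: (is_clifford_transport V4_coord_bij).
have [j_sqr univ] := V4_clifford_std; split=> [x|B f f_sqr].
  by rewrite j_sqr [in RHS]/= V4_coord_form.
by apply: univ => x; rewrite f_sqr /= V4_coord_form.
Qed.
End CliffordV4.

Theorem theorem1 (R : realType) (K : division_alg) (K' : split_alg) :
  let A' := split_star R K' in
  let A := div_star R K in
  let p := (kappa K + kappa'_pos K')%N in
  let m := kappa'_neg K' in
  is_clifford (@V4_form R A' A) (@V4_incl R A' A) /\
  exists g : {linear 'rV[R]_(p + m) -> subvs_of (V4 A' A)},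
    [/\ bijective g,
        forall x, V4_form (g x) = std_form x
      & is_clifford (@std_form R p m) (@V4_incl R A' A \o g)].
Proof.
have two_neq0 : 2%:R != 0 :> R by rewrite pnatr_eq0.
have [N' [u' [NP' u'_bij u'E]]] := split_norm R K'.
have [u [u_bij uE]] := div_norm R K.
have NP := @div_left_composition R K.
move=> A' A p m; split.
  exact: (V4_clifford two_neq0 NP' NP u'_bij u_bij u'E uE).
exists (V4_coord u' u); split.
- exact: V4_coord_bij.
- exact: V4_coord_form NP' NP u'E uE.
- exact: V4_clifford_std.
Qed.
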